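(* Let $E$ be a truncated Riesz space, and let $E\oplus\mathbb{R}$ be its Alexandroff unitization. (1) If $E\oplus\mathbb{R}$ has the projection property, then $E$ has the projection property. (2) If $E$ is unital and has the projection property, then $E\oplus\mathbb{R}$ has the projection property.
   Context: A truncation on a (real) Riesz space $E$ is a map $x\mapsto\bar{x}$ from $E^{+}$ to $E^{+}$ such that for all $a,b\in E^{+}$: $(\tau_1)$ $a\wedge\bar{b}\leq\bar{a}\leq a$; $(\tau_2)$ $\bar{a}=0$ implies $a=0$. A truncated Riesz space is a Riesz space $E$ equipped with a truncation. It is called unital if there exists $u\in E^{+}$ (the truncation unit) such that $\bar{x}=x\wedge u$ for all $x\in E^{+}$. The set of fixed points is $\bar{E}=\{x\in E:\overline{|x|}=|x|\}$. The (Alexandroff) unitization $E\oplus\mathbb{R}=\{x+\lambda: x\in E,\lambda\in\mathbb{R}\}$ is the vector space $E\times\mathbb{R}$ (with $E$ identified with $E\times\{0\}$ and $\mathbb{R}$ with $\{0\}\times\mathbb{R}$, so $1=(0,1)$), ordered by the positive cone $(E\oplus\mathbb{R})^{+}=E^{+}\cup\{x+\lambda: x\in E,\ \lambda\in\mathbb{R},\ \lambda>0,\ \tfrac{1}{\lambda}x^{-}\in\bar{E}\}$. It is known that $E\oplus\mathbb{R}$ is a Riesz space, that $E$ is a vector sublattice (indeed a maximal ideal) of it, and that $\bar{x}=x\wedge 1$ for all $x\in E^{+}$. This space is used whether or not $E$ is unital. A Riesz space $F$ has the projection property if every band $B$ of $F$ is a projection band, i.e. $F=B\oplus B^{d}$,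 where $B^{d}$ is the disjoint complement of $B$ in $F$. *)

(* Defs.v *)
From HB Require Import structures.
From mathcomp Require Import all_boot all_order all_algebra.
From mathcomp Require Import all_classical all_reals.
Set Implicit Arguments.
Unset Strict Implicit.
Unset Printing Implicit Defensive.
Import Order.TTheory GRing.Theory Num.Theory.
Local Open Scope classical_set_scope.
Local Open Scope ring_scope.

(* The lattice operations are fields of this mixin, rather than inherited from
   [Order.Lattice]: the existing structure [Num.RealDomain] already combines a
   lattice with an additive group, so Hierarchy Builder admits no new structure
   that does so.  [Order.Lattice] is recovered just below. *)
HB.mixin Record POrderedLmodule_isRiesz (R : numDomainType) (E : Type)
    of GRing.Lmodule R E & Order.POrder ring_display E := {
  riesz_meet : E -> E -> E;
  riesz_join : E -> E -> E;
  riesz_meetP : forall x y z : E,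
    (x <= riesz_meet y z) = (x <= y) && (x <= z);
  riesz_joinP : forall x y z : E,
    (riesz_join x y <= z) = (x <= z) && (y <= z);
  riesz_leD2l : forall x y z : E, x <= y -> z + x <= z + y;
  riesz_scaler_ge0 : forall (a : R) (x : E), 0 <= a -> 0 <= x -> 0 <= a *: x
}.

#[short(type="rieszType")]
HB.structure Definition Riesz (R : numDomainType) :=
  { E of POrderedLmodule_isRiesz R E & GRing.Lmodule R E
       & Num.POrderedZmodule E }.

HB.instance Definition _ (R : numDomainType) (E : rieszType R) :=
  @Order.POrder_MeetJoin_isLattice.Build ring_display E
    (@riesz_meet R E) (@riesz_join R E) (@riesz_meetP R E) (@riesz_joinP R E).

Section RieszNotions.
Variables (R : numDomainType) (E : rieszType R).
Implicit Types (x y : E) (A B : set E).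

Definition rpos x : E := Order.join x 0.
Definition rneg x : E := Order.join (- x) 0.
Definition rabs x : E := Order.join x (- x).

Definition linear_subspace B :=
  [/\ B 0, forall x y, B x -> B y -> B (x + y)
    & forall (a : R) x, B x -> B (a *: x)].

Definition solid B := forall x y, B y -> rabs x <= rabs y -> B x.

Definition order_ideal B := linear_subspace B /\ solid B.

(* [supremums A] is the set of least upper bounds of [A], so this is closure
   under those suprema that exist in [E]. *)
Definition sup_closed B := forall A, A `<=` B -> supremums A `<=` B.

Definition band B := order_ideal B /\ sup_closed B.

Definition disjoint_compl A : set E :=
  [set x | forall y, A y -> Order.meet (rabs x) (rabs y) = 0].

Definition projection_band B :=
  [set y + z | y in B & z in disjoint_compl B] = setT /\
  B `&` disjoint_compl B = [set 0].

End RieszNotions.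

Definition projection_property (R : numDomainType) (E : rieszType R) :=
  forall B : set E, band B -> projection_band B.

(* [trunc] is a total function, but only its values on the positive cone are
   constrained, and only those are ever used. *)
HB.mixin Record Riesz_isTruncated (R : numDomainType) (E : Type)
    of Riesz R E := {
  trunc : E -> E;
  trunc_ge0 : forall a : E, 0 <= a -> 0 <= trunc a;
  riesz_meet_trunc_le : forall a b : E, 0 <= a -> 0 <= b ->
    riesz_meet a (trunc b) <= trunc a;
  trunc_le : forall a : E, 0 <= a -> trunc a <= a;
  trunc_eq0 : forall a : E, 0 <= a -> trunc a = 0 -> a = 0
}.

#[short(type="truncatedRieszType")]
HB.structure Definition TruncatedRiesz (R : numDomainType) :=
  { E of Riesz_isTruncated R E & Riesz R E }.

HB.instance Definition _ (R : numDomainType) (E : truncatedRieszType R) :=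
  Order.Lattice.copy E (E : rieszType R).

Definition unital (R : numDomainType) (E : truncatedRieszType R) :=
  exists2 u : E, 0 <= u & forall x : E, 0 <= x -> trunc x = Order.meet x u.

Definition trunc_fixed (R : numDomainType) (E : truncatedRieszType R) :
    pred E :=
  fun x => trunc (rabs x) == rabs x.

Definition unitization (R : realFieldType) (E : truncatedRieszType R) : Type :=
  (E * R^o)%type.

HB.instance Definition _ (R : realFieldType) (E : truncatedRieszType R) :=
  GRing.Lmodule.copy (unitization E) (E * R^o)%type.

Section UnitizationOrder.
Variables (R : realFieldType) (E : truncatedRieszType R).

Definition unitization_cone (p : unitization E) : bool :=
  let: (x, a) := p in
  (a == 0) && (0 <= x) || (0 < a) && trunc_fixed (a^-1 *: rneg x).

Definition unitization_le (p q : unitization E) : bool :=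
  unitization_cone (q - p).

End UnitizationOrder.

Section RieszTheory.
Variables (R : realFieldType) (E : rieszType R).
Implicit Types (x y z : E) (a : R).

Lemma rz_leD2l z x y : (z + x <= z + y) = (x <= y).
Proof.
apply/idP/idP; last exact: riesz_leD2l.
by move=> /(riesz_leD2l _ _ (- z)); rewrite !addKr.
Qed.

Lemma rz_leD2r z x y : (x + z <= y + z) = (x <= y).
Proof. by rewrite ![_ + z]addrC rz_leD2l. Qed.

Lemma rz_subr_ge0 x y : (0 <= y - x) = (x <= y).
Proof. by rewrite -(rz_leD2r x 0) add0r subrK. Qed.

Lemma rz_leBlDr x y z : (x - y <= z) = (x <= z + y).
Proof. by rewrite -[LHS](rz_leD2r y) subrK. Qed.

Lemma rz_leBlDl x y z : (x - y <= z) = (x <= y + z).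
Proof. by rewrite rz_leBlDr addrC. Qed.

Lemma rz_leBrDr x y z : (x <= y - z) = (x + z <= y).
Proof. by rewrite -[LHS](rz_leD2r z) subrK. Qed.

Lemma rz_leD x y z t : x <= y -> z <= t -> x + z <= y + t.
Proof.
move=> xy zt; apply: (@le_trans _ _ (y + z)).
  by rewrite rz_leD2r.
by rewrite rz_leD2l.
Qed.

Lemma rz_leN2 x y : (- x <= - y) = (y <= x).
Proof. by rewrite -[RHS]rz_subr_ge0 -[LHS]rz_subr_ge0 opprK addrC. Qed.

Lemma rz_addr_ge0 x y : 0 <= x -> 0 <= y -> 0 <= x + y.
Proof. by move=> x0 y0; rewrite -[0]addr0; apply: rz_leD. Qed.

Lemma rz_leZ2l a x y : 0 <= a -> x <= y -> a *: x <= a *: y.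
Proof.
move=> a0 xy; rewrite -rz_subr_ge0 -scalerBr.
by apply: riesz_scaler_ge0 => //; rewrite rz_subr_ge0.
Qed.

Lemma rz_leZ2r a b x : 0 <= x -> a <= b -> a *: x <= b *: x.
Proof.
move=> x0 ab; rewrite -rz_subr_ge0 -scalerBl.
by apply: riesz_scaler_ge0 => //; rewrite subr_ge0.
Qed.

Lemma rz_invZ_ge0 a x : 0 < a -> 0 <= x -> 0 <= a^-1 *: x.
Proof. by move=> a0; apply: riesz_scaler_ge0; rewrite invr_ge0 ltW. Qed.

Lemma rz_leZpMl a x y : 0 < a -> (a *: x <= a *: y) = (x <= y).
Proof.
move=> a0; apply/idP/idP => [|?]; last exact: rz_leZ2l (ltW a0) _.
move=> /(@rz_leZ2l a^-1); rewrite !scalerK ?gt_eqF//; apply.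
by rewrite invr_ge0 ltW.
Qed.

Lemma rz_leVZ a x y : 0 < a -> (a^-1 *: x <= y) = (x <= a *: y).
Proof. by move=> a0; rewrite -[LHS](rz_leZpMl _ _ a0) scalerKV ?gt_eqF. Qed.

Lemma rneg_ge0 x : 0 <= rneg x.
Proof. exact: leUr. Qed.

Lemma rpos_ge0 x : 0 <= rpos x.
Proof. exact: leUr. Qed.

Lemma rneg_le x y : 0 <= y -> (rneg x <= y) = (- x <= y).
Proof. by move=> y0; rewrite leUx y0 andbT. Qed.

Lemma rpos_rneg x : rpos x = x + rneg x.
Proof.
apply/le_anti/andP; split.
  rewrite leUx -!rz_leBlDl subrr sub0r rneg_ge0.
  exact: leUl.
rewrite addrC -rz_leBrDr leUx !rz_leBrDr addNr add0r.
by rewrite rpos_ge0 leUl.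
Qed.

Lemma rabs_ge0_id x : 0 <= x -> rabs x = x.
Proof.
move=> x0; apply/join_l/(le_trans _ x0).
by rewrite -oppr0 rz_leN2.
Qed.

Lemma le_rneg_rpos x y z : 0 <= y -> z <= rneg x -> z <= y + rpos x -> z <= y.
Proof.
move=> y0 z1 z2.
have h : z - y <= Order.meet (rneg x) (rpos x).
  rewrite lexI; apply/andP; split; last by rewrite rz_leBlDl.
  by apply: (le_trans _ z1); rewrite rz_leBlDr -[X in X <= _]addr0 rz_leD2l.
suff d : Order.meet (rneg x) (rpos x) <= 0.
  by move: (le_trans h d); rewrite rz_leBlDr add0r.
set m := Order.meet _ _.
have : rneg x <= rneg x - m.
  rewrite leUx rz_subr_ge0 leIl andbT.
  by rewrite rz_leBrDr addrC rz_leBlDl -rpos_rneg leIr.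
by rewrite rz_leBrDr -[X in _ <= X]addr0 rz_leD2l.
Qed.

End RieszTheory.

Section UnitizationLattice.
Variables (R : realFieldType) (E : truncatedRieszType R).
Implicit Types (x y f g : E) (a b : R) (p q : unitization E).

Lemma meet_trunc_le x y : 0 <= x -> 0 <= y ->
  Order.meet x (trunc y) <= trunc x.
Proof. exact: riesz_meet_trunc_le. Qed.

Let fixed0 f := (0 <= f) && (trunc f == f).

Lemma trunc_fixed_ge0 f : 0 <= f -> trunc_fixed f = (trunc f == f).
Proof. by move=> f0; rewrite /trunc_fixed rabs_ge0_id. Qed.

Lemma trunc_trunc f : 0 <= f -> trunc (trunc f) = trunc f.
Proof.
move=> f0; have tf0 := trunc_ge0 _ f0.
apply/le_anti; rewrite trunc_le//=.
by have := meet_trunc_le tf0 f0; rewrite meetxx.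
Qed.

Let fixed0U f g : fixed0 f -> fixed0 g -> fixed0 (Order.join f g).
Proof.
move=> /andP[f0 /eqP ff] /andP[g0 /eqP gg].
have s0 : 0 <= Order.join f g by apply/(le_trans f0)/leUl.
rewrite /fixed0 s0 eq_le trunc_le//= leUx; apply/andP; split.
- rewrite -[X in X <= _](_ : Order.meet (Order.join f g) (trunc f) = _).
    exact: meet_trunc_le.
  by rewrite ff; apply/meet_r/leUl.
- rewrite -[X in X <= _](_ : Order.meet (Order.join f g) (trunc g) = _).
    exact: meet_trunc_le.
  by rewrite gg; apply/meet_r/leUr.
Qed.

Let fixed0W f g : 0 <= f -> f <= g -> fixed0 g -> fixed0 f.
Proof.
move=> f0 fg /andP[g0 /eqP gg].
rewrite /fixed0 f0 eq_le trunc_le//=.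
by have := meet_trunc_le f0 g0; rewrite gg (meet_l fg).
Qed.

Let fixed00 : fixed0 0.
Proof. by rewrite /fixed0 lexx eq_le trunc_le ?trunc_ge0. Qed.

Let coneP x a : reflect
  (0 <= a /\ exists2 f, fixed0 f & - x <= a *: f)
  (unitization_cone (x, a)).
Proof.
apply: (iffP orP) => [[/andP[/eqP-> x0]|/andP[a0]]|[]].
- split=> //; exists 0; first exact: fixed00.
  by rewrite scaler0 -oppr0 rz_leN2.
- have n0 : 0 <= a^-1 *: rneg x by apply/rz_invZ_ge0/rneg_ge0.
  rewrite trunc_fixed_ge0// => n1; split; first exact: ltW.
  exists (a^-1 *: rneg x); first by rewrite /fixed0 n0.
  by rewrite scalerKV ?gt_eqF// leUl.
- rewrite le_eqVlt => /orP[/eqP<-|a0] [f ff xf].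
    by left; rewrite eqxx -rz_leN2 oppr0 -(scale0r f).
  right; rewrite a0 /=.
  have n0 : 0 <= a^-1 *: rneg x by apply/rz_invZ_ge0/rneg_ge0.
  rewrite trunc_fixed_ge0//.
  suff /andP[] : fixed0 (a^-1 *: rneg x) by [].
  apply: (fixed0W n0 _ ff).
  rewrite rz_leVZ// rneg_le//; case/andP: ff => f0 _.
  exact/riesz_scaler_ge0/f0/ltW.
Qed.

Let coneD p q : unitization_cone p -> unitization_cone q ->
  unitization_cone (p + q).
Proof.
case: p q => x a [y b] /coneP[a0 [f ff xf]] /coneP[b0 [g gg yg]].
apply/coneP; split; first exact: addr_ge0.
exists (Order.join f g); first exact: fixed0U.
rewrite opprD scalerDl; apply: rz_leD.
- exact/(le_trans xf)/rz_leZ2l/leUl.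
- exact/(le_trans yg)/rz_leZ2l/leUr.
Qed.

Fact unitization_le_refl : reflexive (@unitization_le R E).
Proof.
by move=> p; rewrite /unitization_le subrr /unitization_cone /= eqxx lexx.
Qed.

Fact unitization_le_anti : antisymmetric (@unitization_le R E).
Proof.
move=> p q /andP[]; rewrite /unitization_le -[p - q]opprB => pq qp.
suff : q - p = 0 by move/eqP; rewrite subr_eq0 => /eqP.
case: (q - p) pq qp => x a /coneP[a0 [f ff xf]] /coneP[/= a0' [g gg xg]].
have a1 : a = 0 by apply/le_anti; rewrite a0 andbT -oppr_ge0.
subst a; rewrite scale0r -oppr0 rz_leN2 in xf.
rewrite oppr0 scale0r opprK in xg.
by congr pair; apply/le_anti; rewrite xf xg.
Qed.

Fact unitization_le_trans : transitive (@unitization_le R E).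
Proof.
move=> q p r pq qr; rewrite /unitization_le -[r](subrK q) -addrA.
exact: coneD.
Qed.

HB.instance Definition _ := Choice.copy (unitization E) (E * R^o)%type.
HB.instance Definition _ := @Order.Le_isPOrder.Build ring_display
  (unitization E) (@unitization_le R E)
  unitization_le_refl unitization_le_anti unitization_le_trans.

Lemma unitization_leE p q : (p <= q) = unitization_cone (q - p).
Proof. by []. Qed.

Let posP p q : Prop := forall r, (q <= r) = (p <= r) && (0 <= r).

Let le_D2l r p q : (r + p <= r + q) = (p <= q).
Proof. by rewrite !unitization_leE opprD addrACA subrr add0r. Qed.

(* For a > 0, (x + a)^- is the vector x^- - a (trunc (x^- / a)) of E, and
   w^+ = w + (- w)^+ reduces the case a < 0 to this one. *)
Let upos_nneg p : unitization E :=
  let: (x, a) := p in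
  if 0 < a then (rpos x - a *: trunc (a^-1 *: rneg x), a) else (rpos x, 0).

Definition unitization_pos p : unitization E :=
  if p.2 < 0 then p + upos_nneg (- p) else upos_nneg p.

Let upos_gt0 x a : 0 < a -> posP (x, a) (upos_nneg (x, a)).
Proof.
move=> a0 [y b]; rewrite /upos_nneg a0.
set t := trunc _.
have n0 : 0 <= a^-1 *: rneg x by apply/rz_invZ_ge0/rneg_ge0.
have tt : fixed0 t by rewrite /fixed0 trunc_ge0//= trunc_trunc.
have t0 : 0 <= t by case/andP: tt.
have tle : a *: t <= rneg x.
  by rewrite -[a in a *: t]invrK rz_leVZ ?invr_gt0// trunc_le.
apply/idP/andP => [h|[]].
  split; apply: le_trans h; rewrite unitization_leE.
    apply/coneP => /=; rewrite subrr; split=> //; exists 0 => //.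
    rewrite scaler0 rpos_rneg -oppr0 rz_leN2.
    by rewrite addrAC [x + _]addrC addrK rz_subr_ge0.
  rewrite subr0; apply/coneP; split; first exact: ltW.
  exists t => //; rewrite opprB rz_leBlDr -[X in X <= _]addr0 rz_leD2l.
  exact: rpos_ge0.
rewrite !unitization_leE subr0 => /coneP[/= ab [g gg xg]] /coneP[b0 [f ff yf]].
apply/coneP => /=; split=> //.
set k := Order.join f g; exists k; first exact: fixed0U.
have k0 : 0 <= k by case/andP: ff => f0 _; apply/(le_trans f0)/leUl.
have kk : fixed0 k by exact: fixed0U.
have {}yf : - y <= b *: k by apply/(le_trans yf)/rz_leZ2l/leUl.
have {}xg : - (y - x) <= (b - a) *: k.
  by apply/(le_trans xg)/rz_leZ2l/leUr.
rewrite !opprB addrAC rz_leBlDl [a *: t + _]addrC -rz_leBlDl.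
set w := _ - _.
have w1 : w <= rneg x.
  rewrite /w rz_leBlDl rpos_rneg addrAC rz_leD2r.
  by rewrite -[x - y]opprB.
have w2 : w <= a *: k + rpos x.
  rewrite /w rz_leBlDl addrA -scalerDl subrK addrC rz_leD2r.
  exact: yf.
have ak0 : 0 <= a *: k by apply/riesz_scaler_ge0/k0/ltW.
have w3 : w <= a *: k by exact: le_rneg_rpos w1 w2.
rewrite -rz_leVZ//.
have : a^-1 *: w <= Order.meet (a^-1 *: rneg x) (trunc k).
  rewrite lexI; apply/andP; split.
    by apply: rz_leZ2l w1; rewrite invr_ge0 ltW.
  by case/andP: kk => _ /eqP->; rewrite rz_leVZ.
by move=> /le_trans; apply; apply: meet_trunc_le.
Qed.

Let upos0 x : posP (x, 0) (upos_nneg (x, 0)).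
Proof.
move=> [y b]; rewrite /upos_nneg ltxx.
apply/idP/andP => [h|[]].
  split; apply: le_trans h; rewrite unitization_leE.
    apply/coneP => /=; rewrite subrr; split=> //; exists 0 => //.
    by rewrite scaler0 opprB rz_leBlDr add0r leUl.
  rewrite subr0; apply/coneP; split => //; exists 0 => //.
  by rewrite scaler0 -oppr0 rz_leN2 rpos_ge0.
rewrite !unitization_leE subr0 => /coneP[/= ab [g gg xg]] /coneP[b0 [f ff yf]].
rewrite subr0 in xg.
apply/coneP => /=; rewrite subr0; split=> //.
exists (Order.join f g); first exact: fixed0U.
rewrite opprB rz_leBlDr leUx; apply/andP; split.
  by rewrite -rz_leBlDr -[x - y]opprB; apply/(le_trans xg)/rz_leZ2l/leUr.
by rewrite -rz_leBlDr sub0r; apply/(le_trans yf)/rz_leZ2l/leUl.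
Qed.

Let posP_opp p q : posP (- p) q -> posP p (p + q).
Proof.
move=> h r; rewrite -[LHS](le_D2l (- p)) addKr h andbC; congr andb.
  by rewrite -[LHS](le_D2l p) addr0 addNKr.
by rewrite -[LHS](le_D2l p) subrr addNKr.
Qed.

Lemma unitization_posP p q :
  (unitization_pos p <= q) = (p <= q) && (0 <= q).
Proof.
case: p => x a; rewrite /unitization_pos.
change (x, a).2 with a; case: ltgtP => [a0|a0|->]; last exact: upos0.
- by apply: posP_opp; apply: upos_gt0; rewrite oppr_gt0.
- exact: upos_gt0.
Qed.

Let unitization_le_sub p q : (0 <= q - p) = (p <= q).
Proof. by rewrite !unitization_leE subr0. Qed.

Let ujoin p q := q + unitization_pos (p - q).
Let umeet p q := p + q - ujoin p q.

Fact unitization_joinP p q r : (ujoin p q <= r) = (p <= r) && (q <= r).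
Proof.
rewrite -[LHS](le_D2l (- q)) addKr unitization_posP [- q + r]addrC.
by rewrite unitization_le_sub -(le_D2l q (p - q)) ![q + (_ - q)]addrC !subrK.
Qed.

Fact unitization_meetP p q r : (p <= umeet q r) = (p <= q) && (p <= r).
Proof.
have e (s t : unitization E) : (- s <= - t) = (t <= s).
  by rewrite !unitization_leE opprK addrC.
rewrite -[LHS]e /umeet opprB -[LHS](le_D2l (q + r)) addrCA subrr addr0.
rewrite unitization_joinP -(unitization_le_sub q) -(unitization_le_sub r).
rewrite addrAC [q + r - p - r]addrAC addrK [q + r]addrC addrK.
by rewrite !unitization_le_sub andbC.
Qed.

Fact unitization_leD2l p q r : p <= q -> r + p <= r + q.
Proof. by rewrite le_D2l. Qed.

Fact unitization_scaler_ge0 a p : 0 <= a -> 0 <= p -> 0 <= a *: p.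
Proof.
case: p => x b a0; rewrite !unitization_leE !subr0.
move=> /coneP[b0 [f ff xf]]; apply/coneP; split; first exact: mulr_ge0.
by exists f => //; rewrite -scalerN -scalerA; apply: rz_leZ2l.
Qed.

HB.instance Definition _ := @POrderedLmodule_isRiesz.Build R (unitization E)
  umeet ujoin unitization_meetP unitization_joinP
  unitization_leD2l unitization_scaler_ge0.
HB.instance Definition _ :=
  Order.Lattice.copy (unitization E) (unitization E : rieszType R).

End UnitizationLattice.

Section UnitizationEmbedding.
Variables (R : realFieldType) (E : truncatedRieszType R).
Implicit Types x y : E.

Definition unitization_inj x : unitization E := (x, 0).
Definition unitization_one : unitization E := (0, 1).
Local Notation inj := unitization_inj.
Local Notation one := unitization_one.

Lemma unitization_le_inj x y : (inj x <= inj y) = (x <= y).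
Proof.
rewrite unitization_leE /unitization_cone /= subrr eqxx ltxx orbF.
exact: rz_subr_ge0.
Qed.

Lemma unitization_inj_le_one x : 0 <= x -> (inj x <= one) = (trunc x == x).
Proof.
move=> x0; rewrite unitization_leE /unitization_cone /= subr0 oner_eq0 ltr01 /=.
rewrite invr1 scale1r sub0r.
have -> : rneg (- x) = x by rewrite /rneg opprK; apply/join_l.
by rewrite trunc_fixed_ge0.
Qed.

Lemma unitization_meet_one x : 0 <= x ->
  Order.meet (inj x) one = inj (trunc x).
Proof.
move=> x0; have tx := trunc_ge0 _ x0.
have e0 : inj 0 <= Order.meet (inj x) one.
  by rewrite lexI unitization_le_inj x0 unitization_inj_le_one // eq_le trunc_le // trunc_ge0.
apply: le_anti; apply/andP; split; last first.
  rewrite lexI unitization_le_inj unitization_inj_le_one // trunc_trunc //.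
  by rewrite trunc_le //= eqxx.
have h1 := leIl (inj x) one.
have h2 := leIr one (inj x).
case: (Order.meet _ _) e0 h1 h2 => y b e0 h1 h2.
have b0 : b = 0.
  move: e0 h1; rewrite !unitization_leE /unitization_cone /= subr0 sub0r.
  rewrite oppr_eq0 oppr_gt0.
  by case: ltgtP.
subst b; rewrite -!/(inj y) !unitization_le_inj in e0 h1 h2 *.
rewrite unitization_inj_le_one // in h2.
by rewrite -[X in X <= _](meet_r h1) -{1}(eqP h2); apply: meet_trunc_le.
Qed.

Lemma unitization_inj_join x y :
  Order.join (inj x) (inj y) =
  inj (Order.join x y).
Proof.
apply: le_anti; rewrite leUx !unitization_le_inj leUl leUr /=.
have h1 := leUl (inj x) (inj y).
have h2 := leUr (inj y) (inj x).
have h3 : Order.join (inj x) (inj y) <= inj (Order.join x y).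
  by rewrite leUx !unitization_le_inj leUl leUr.
case: (Order.join _ _) h1 h2 h3 => z b h1 h2 h3.
have b0 : b = 0.
  move: h1 h3; rewrite !unitization_leE /unitization_cone /= subr0 sub0r.
  rewrite oppr_eq0 oppr_gt0.
  by case: ltgtP.
subst b.
rewrite -!/(inj z) !unitization_le_inj in h1 h2 h3 *.
by rewrite leUx h1.
Qed.

End UnitizationEmbedding.

(* Main.v *)
Require Import Defs.
From mathcomp Require Import all_boot all_order all_algebra.
From mathcomp Require Import all_classical all_reals.

(** Only the fact that [E] is an order ideal of [E (+) R] matters for (1): a
    band [B] of [E] is the trace on [E] of the band of those [f] with
    [|f| /\ x] in [B] for all positive [x] in [E], and a decomposition of an
    element of [E] along this band stays in [E].  For (2), if [u] is the
    truncation unit then [1 - u] is positive and disjoint from [E], so that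
    [E (+) R] is the order direct sum of [E] and of the line [R (1 - u)], and
    every band splits accordingly. *)

Set Implicit Arguments.
Unset Strict Implicit.
Unset Printing Implicit Defensive.
Import Order.TTheory GRing.Theory Num.Theory.
Local Open Scope classical_set_scope.
Local Open Scope ring_scope.

(** * Absolute value, disjointness and suprema in a Riesz space *)

Section Riesz.
Variables (R : realFieldType) (E : rieszType R).
Implicit Types (x y z w : E) (a : R) (A B : set E).

Lemma rz_oppU x y : - Order.join x y = Order.meet (- x) (- y).
Proof.
apply/le_anti/andP; split.
  by rewrite lexI !rz_leN2 leUl leUr.
by rewrite -rz_leN2 opprK leUx -rz_leN2 opprK leIl -rz_leN2 opprK leIr.
Qed.

Lemma rz_addrI z x y : z + Order.meet x y = Order.meet (z + x) (z + y).
Proof.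
apply/le_anti/andP; split; first by rewrite lexI !rz_leD2l leIl leIr.
by rewrite -rz_leBlDl lexI !rz_leBlDl leIl leIr.
Qed.

(** Equivalently, [y - y /\ z] increases with [y], which drives the distributive law for suprema
    below. *)
Lemma rz_addr_meet_mono x y z : x <= y ->
  x + Order.meet y z <= y + Order.meet x z.
Proof.
move=> xy; rewrite [leRHS]rz_addrI lexI [y + x]addrC rz_leD2l leIl /=.
by apply: rz_leD => //; exact: leIr.
Qed.

Lemma rz_half_ge0 x : 0 <= x + x -> 0 <= x.
Proof.
have -> : x + x = 2%:R *: x by rewrite scaler_nat mulr2n.
by rewrite -[0 in X in X -> _](scaler0 _ 2%:R) rz_leZpMl.
Qed.

Lemma rabs_ge0 x : 0 <= rabs x.
Proof.
by apply: rz_half_ge0; rewrite -(subrr x); apply: rz_leD; [exact: leUl|exact: leUr].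
Qed.

Lemma rabs_le x y : (rabs x <= y) = (x <= y) && (- x <= y).
Proof. exact: leUx. Qed.

Lemma le_rabs x : x <= rabs x.
Proof. exact: leUl. Qed.

Lemma rabsN x : rabs (- x) = rabs x.
Proof. by rewrite /rabs opprK joinC. Qed.

Lemma leN_rabs x : - x <= rabs x.
Proof. by rewrite -rabsN le_rabs. Qed.

Lemma rabs0 : rabs (0 : E) = 0.
Proof. exact: rabs_ge0_id. Qed.

Lemma rabs_eq0 x : rabs x = 0 -> x = 0.
Proof.
move=> h; apply/le_anti; rewrite -h le_rabs /= h -rz_leN2 oppr0 -h -rabsN.
exact: le_rabs.
Qed.

Lemma rabsD x y : rabs (x + y) <= rabs x + rabs y.
Proof.
by rewrite rabs_le opprD !rz_leD ?le_rabs ?leN_rabs.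
Qed.

Lemma rabsZ_le a x : rabs (a *: x) <= `|a| *: rabs x.
Proof.
rewrite rabs_le; have [a0|a0] := leP 0 a.
  rewrite ger0_norm//.
  by rewrite -scalerN !rz_leZ2l ?le_rabs ?leN_rabs.
have -> : a *: x = - a *: (- x) by rewrite scalerN scaleNr opprK.
rewrite ltr0_norm// -scalerN opprK.
by rewrite !rz_leZ2l ?oppr_ge0 ?(ltW a0) ?le_rabs ?leN_rabs.
Qed.

Lemma rpos_le_rabs x : rpos x <= rabs x.
Proof. by rewrite leUx le_rabs rabs_ge0. Qed.

Lemma rneg_le_rabs x : rneg x <= rabs x.
Proof. by rewrite leUx leN_rabs rabs_ge0. Qed.

Lemma rneg_anti x y : x <= y -> rneg y <= rneg x.
Proof. by rewrite -rz_leN2 => xy; rewrite leUx rneg_ge0 (le_trans xy)// leUl. Qed.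

(** The right side expands into the meet of the four sums [y + z], [y + x], [x + z] and [x + x],
    each above the left side. *)
Lemma rz_meetDl_le x y z : 0 <= x -> 0 <= y -> 0 <= z ->
  Order.meet (y + z) x <= Order.meet y x + Order.meet z x.
Proof.
move=> x0 y0 z0; set w := Order.meet (y + z) x.
have wx : w <= x by exact: leIr.
rewrite rz_addrI lexI ![Order.meet y x + _]addrC !rz_addrI !lexI.
have xD t : 0 <= t -> w <= t + x.
  by move=> t0; rewrite -(add0r w); apply: rz_leD.
by rewrite xD// ?(xD x)// [x + y]addrC xD// [z + y]addrC leIl.
Qed.

(** The factor [1 + a] dominates both [a] and [1], and stays invertible when [a] is [0]. *)
Lemma rz_meetZl_le a x y : 0 <= a -> 0 <= x -> 0 <= y ->
  Order.meet (a *: x) y <= (1 + a) *: Order.meet x y.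
Proof.
move=> a0 x0 y0.
have a1 : 0 < 1 + a by rewrite (lt_le_trans ltr01)// lerDl.
rewrite -[Order.meet (a *: x) y](scalerKV (lt0r_neq0 a1)).
apply: rz_leZ2l; first exact: ltW.
rewrite lexI !rz_leVZ//; apply/andP; split.
  by apply: le_trans (leIl _ _) _; apply: rz_leZ2r => //; rewrite lerDr.
apply: le_trans (leIr _ _) _; rewrite -{1}[y]scale1r; apply: rz_leZ2r => //.
by rewrite lerDl.
Qed.

Lemma meet_rabs_ge0 x y : 0 <= Order.meet (rabs x) (rabs y).
Proof. by rewrite lexI !rabs_ge0. Qed.

(** Meet [|x| <= |x + y| + |y|] with [|x|]: by subadditivity the term in [y] vanishes. *)
Lemma rabs_le_disjointD x y :
  Order.meet (rabs x) (rabs y) = 0 -> rabs x <= rabs (x + y).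
Proof.
move=> xy0.
have h : rabs x <= rabs (x + y) + rabs y.
  by rewrite -{1}[x](addrK y) -[rabs y]rabsN; exact: rabsD.
have := rz_meetDl_le (rabs_ge0 x) (rabs_ge0 (x + y)) (rabs_ge0 y).
rewrite [Order.meet (rabs y) _]meetC xy0 addr0 (meet_r h) => /le_trans; apply.
exact: leIl.
Qed.

Lemma disjoint_complD A x y : disjoint_compl A x -> disjoint_compl A y ->
  disjoint_compl A (x + y).
Proof.
move=> dx dy z Az; apply/le_anti; rewrite meet_rabs_ge0 andbT.
rewrite -[leRHS](addr0 0) -{1}(dx z Az) -(dy z Az).
apply: le_trans (rz_meetDl_le _ _ _); rewrite ?rabs_ge0//.
by apply: leI2 => //; exact: rabsD.
Qed.

(** An element disjoint from itself is zero, so only the decomposition half of [projection_band]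
    remains to be shown for a band. *)
Lemma setI_disjoint_compl B : B 0 -> B `&` disjoint_compl B = [set 0].
Proof.
move=> B0; apply/seteqP; split => [x [Bx /(_ x Bx)]|_ ->].
  by rewrite meetxx => /rabs_eq0.
by split=> // y _; rewrite rabs0; apply/meet_l/rabs_ge0.
Qed.

Lemma solid_le B x y : solid B -> B y -> 0 <= x -> x <= y -> B x.
Proof.
move=> sB By x0 xy; apply: sB By _.
by rewrite !rabs_ge0_id// (le_trans x0).
Qed.

Lemma solid_rabs B x : solid B -> B (rabs x) <-> B x.
Proof.
by move=> sB; split=> Bx; apply: sB Bx _; rewrite (rabs_ge0_id (rabs_ge0 x)).
Qed.

(** [sup_closed] also covers the empty set. A least upper bound [x] of it lies below both [0] and
    [x + x]. *)
Lemma supremums_set0 x : supremums (set0 : set E) x -> x = 0.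
Proof.
move=> [_ lb]; have le_x y : x <= y by apply: lb => ? [].
by apply/le_anti; rewrite le_x -(rz_leD2l x) addr0 le_x.
Qed.

(** Infinite distributivity; the positive parts serve [band_extend], where the meets with [x] must
    lie between [0] and [x]. *)
Lemma supremums_rpos_meet A s x : A !=set0 -> supremums A s ->
  supremums [set Order.meet (rpos y) x | y in A] (Order.meet (rpos s) x).
Proof.
move=> [a0 Aa0] [ubs lbs].
have rpos_le (a : E) : A a -> rpos a <= rpos s.
  by move=> /ubs as_; rewrite /rpos leUx leUr andbT (le_trans as_)// leUl.
split=> [_ [a Aa <-]|z ubz]; first by apply: leI2 => //; exact: rpos_le.
(* [t] is chosen so that [s^+ <= t] rearranges to [s^+ /\ x <= z]. *)
pose t := z + rpos s - Order.meet (rpos s) x.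
have rpos_le_t (a : E) : A a -> rpos a <= t.
  move=> Aa; rewrite rz_leBrDr; apply: le_trans (rz_addr_meet_mono _ _) _.
    exact: rpos_le.
  by rewrite addrC rz_leD2r; apply: ubz; exists a.
suff : rpos s <= t by rewrite rz_leBrDr addrC rz_leD2r.
(* Nonemptiness gives [0 <= a0^+ <= t], so only [s <= t] is left. *)
rewrite {1}/rpos leUx (le_trans (rpos_ge0 a0) (rpos_le_t _ Aa0)) andbT.
by apply: lbs => a Aa; apply: le_trans (rpos_le_t _ Aa); exact: leUl.
Qed.

End Riesz.

(** * [E] as an order ideal of its unitization *)

Section Unitization.
Variables (R : realFieldType) (E : truncatedRieszType R).
Implicit Types (x y z : E) (a : R) (p q : unitization E) (B : set E)
  (C : set (unitization E)).
Local Notation inj := (@unitization_inj R E).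

Lemma unitization_injD x y : inj (x + y) = inj x + inj y.
Proof. by congr pair; rewrite addr0. Qed.

Lemma unitization_injN x : inj (- x) = - inj x.
Proof. by congr pair; rewrite oppr0. Qed.

Lemma unitization_injZ a x : inj (a *: x) = a *: inj x.
Proof. by congr pair; rewrite scaler0. Qed.

Lemma unitization_inj_rabs x : rabs (inj x) = inj (rabs x).
Proof. by rewrite /rabs -unitization_injN unitization_inj_join. Qed.

Lemma unitization_inj_meet x y :
  Order.meet (inj x) (inj y) = inj (Order.meet x y).
Proof.
rewrite -[x]opprK -[y]opprK (unitization_injN (- x)) (unitization_injN (- y)).
by rewrite -!rz_oppU unitization_inj_join unitization_injN.
Qed.

Lemma unitization_le_snd p q : p <= q -> p.2 <= q.2.
Proof.
case: p q => x a [y b]; rewrite unitization_leE /unitization_cone /= subr_eq0.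
by case/orP=> /andP[]; [move=> /eqP->|rewrite subr_gt0 => /ltW].
Qed.

(** The real coordinate is monotone, hence squeezed between [0] and [0]. *)
Lemma unitization_inj_between x y p :
  inj x <= p -> p <= inj y -> exists z, p = inj z.
Proof.
move=> /unitization_le_snd /= p0 /unitization_le_snd /= p1; exists p.1.
case: p p0 p1 => z a /= p0 p1; congr pair.
by apply/le_anti; rewrite p0 p1.
Qed.

Lemma unitization_rabs_le_inj p y : rabs p <= inj y -> exists x, p = inj x.
Proof.
move=> py; apply: (@unitization_inj_between (- y) y).
  by rewrite unitization_injN -rz_leN2 opprK (le_trans (leN_rabs _)).
exact: le_trans (le_rabs _) py.
Qed.

Lemma unitization_meet_inj p x : 0 <= p -> 0 <= x ->
  exists y, Order.meet p (inj x) = inj y.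
Proof.
move=> p0 x0; apply: (@unitization_inj_between 0 x); last exact: leIr.
by rewrite lexI p0 unitization_le_inj.
Qed.

(** An upper bound [p] may be replaced by [p /\ s], which lies between a member of [A] and [s],
    hence in [E]. *)
Lemma unitization_inj_supremums (A : set E) s : supremums A s ->
  A !=set0 -> supremums [set inj x | x in A] (inj s).
Proof.
move=> [ubs lbs] [x0 Ax0]; split=> [_ [x Ax <-]|p ubp].
  by rewrite unitization_le_inj; exact: ubs.
have ubm x : A x -> inj x <= Order.meet p (inj s).
  by move=> Ax; rewrite lexI ubp ?unitization_le_inj ?ubs//; exists x.
have [z zE] := unitization_inj_between (ubm _ Ax0) (leIr _ _).
rewrite (le_trans _ (leIl p (inj s)))// zE unitization_le_inj.
by apply: lbs => x /ubm; rewrite zE unitization_le_inj.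
Qed.

Lemma supremums_unitization_inj (A : set E) s :
  supremums [set inj x | x in A] (inj s) -> supremums A s.
Proof.
move=> [ubs lbs]; split=> [x Ax|y uby].
  by rewrite -unitization_le_inj; apply: ubs; exists x.
rewrite -unitization_le_inj; apply: lbs => _ [x Ax <-].
by rewrite unitization_le_inj; exact: uby.
Qed.

(** * Restriction of bands to [E] and extension of bands from [E] *)

Lemma band_trace C : band C -> band [set x | C (inj x)].
Proof.
move=> [[[C0 CD CZ] Cs] Csup]; split; [split; [split|]|].
- exact: C0.
- by move=> x y Cx Cy; rewrite /= unitization_injD; exact: CD.
- by move=> a x Cx; rewrite /= unitization_injZ; exact: CZ.
- move=> x y Cy xy; apply: Cs Cy _.
  by rewrite !unitization_inj_rabs unitization_le_inj.
- move=> A AC s sA; have [A0|A0] := eqVneq A set0.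
    by move: sA; rewrite A0 => /supremums_set0 ->; exact: C0.
  apply: Csup (unitization_inj_supremums sA _); last exact/set0P.
  by move=> _ [x Ax <-]; exact: AC.
Qed.

(** For [p] in [C], the meet of [|p|] and [|x|] is some [y] in [E]. Solidity puts it in the trace of
    [C], so it is disjoint from [x]; being below [|x|], it is zero. *)
Lemma disjoint_compl_trace C x : solid C ->
  disjoint_compl [set y | C (inj y)] x -> disjoint_compl C (inj x).
Proof.
move=> sC dx p Cp; rewrite meetC.
have [||y yE] := @unitization_meet_inj (rabs p) (rabs x); try exact: rabs_ge0.
have y0 : 0 <= y.
  by rewrite -unitization_le_inj -yE -unitization_inj_rabs; exact: meet_rabs_ge0.
have Cy : C (inj y).
  apply: solid_le sC (proj2 (solid_rabs _ sC) Cp) _ _.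
    by rewrite -[0]/(inj 0) unitization_le_inj.
  by rewrite -yE leIl.
have yx : y <= rabs x by rewrite -unitization_le_inj -yE leIr.
rewrite unitization_inj_rabs yE.
by have := dx y Cy; rewrite (rabs_ge0_id y0) (meet_r yx) => ->.
Qed.

(** The meet is formed in the unitization, so membership in [B] is expressed through a preimage
    under [inj]. *)
Definition unitization_extend B : set (unitization E) :=
  [set p | forall x, 0 <= x ->
    exists2 y, B y & Order.meet (rabs p) (inj x) = inj y].

Lemma solid_inj B p y : solid B -> B y -> 0 <= p -> p <= inj y ->
  exists2 z, B z & p = inj z.
Proof.
move=> sB By p0 py; have [z zE] := @unitization_inj_between 0 y p p0 py.
exists z => //; move: p0 py; rewrite zE -[0]/(inj 0) !unitization_le_inj.
exact: solid_le.
Qed.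

(** The map sending [p] to [|p| /\ x] is not linear, but the bounds [rz_meetDl_le] and
    [rz_meetZl_le] suffice because [B] is solid. *)
Lemma order_ideal_extend B : order_ideal B -> order_ideal (unitization_extend B).
Proof.
move=> [[B0 BD BZ] Bs].
have inj_ge0 x : 0 <= x -> 0 <= inj x by rewrite -unitization_le_inj.
have meet_ge0 p x : 0 <= x -> 0 <= Order.meet (rabs p) (inj x).
  by move=> x0; rewrite lexI rabs_ge0 inj_ge0.
split; [split|].
- by move=> x x0; exists 0 => //; rewrite rabs0; apply/meet_l/inj_ge0.
- move=> p q Bp Bq x x0; have [y By yE] := Bp x x0; have [z Bz zE] := Bq x x0.
  apply: solid_inj Bs (BD _ _ By Bz) (meet_ge0 _ _ x0) _.
  rewrite unitization_injD -yE -zE.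
  apply: le_trans (rz_meetDl_le _ _ _); rewrite ?rabs_ge0 ?inj_ge0//.
  by apply: leI2 => //; exact: rabsD.
- move=> a p Bp x x0; have [y By yE] := Bp x x0.
  apply: solid_inj Bs (BZ (1 + `|a|) _ By) (meet_ge0 _ _ x0) _.
  rewrite unitization_injZ -yE.
  apply: le_trans (rz_meetZl_le _ _ _); rewrite ?rabs_ge0 ?inj_ge0//.
  by apply: leI2 => //; exact: rabsZ_le.
- move=> p q Bq pq x x0; have [y By yE] := Bq x x0.
  apply: solid_inj Bs By (meet_ge0 _ _ x0) _.
  by rewrite -yE; apply: leI2.
Qed.

Lemma band_extend B : band B -> band (unitization_extend B).
Proof.
move=> [oB Bsup]; have oC := order_ideal_extend oB.
split=> // A AC s sA; have [[C0 CD CZ] Cs] := oC.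
have [A0|/set0P A0] := eqVneq A set0.
  by move: sA; rewrite A0 => /supremums_set0 ->.
have -> : s = rpos s + (- 1) *: rneg s.
  by rewrite rpos_rneg scaleN1r addrK.
apply: CD; last first.
  (* Any [p] in [A] is below [s], so [s^- <= p^- <= |p|] and solidity applies. *)
  apply: CZ; have [p Ap] := A0; apply: Cs (AC p Ap) _.
  rewrite rabs_ge0_id ?rneg_ge0//; apply: le_trans (rneg_le_rabs p).
  by apply: rneg_anti; exact: sA.1.
move=> x x0; rewrite rabs_ge0_id ?rpos_ge0//.
have [y yE] := unitization_meet_inj (rpos_ge0 s) x0.
exists y => //.
(* By distributivity [s^+ /\ x] is the supremum of the [p^+ /\ x]. All of these lie in [E], so the
   supremum can be read there, where [B] is closed. *)
pose D := [set z | exists2 p, A p & Order.meet (rpos p) (inj x) = inj z].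
have DB : D `<=` B.
  move=> z [p Ap zE]; have [t Bt tE] := AC p Ap x x0.
  have z0 : 0 <= z.
    by rewrite -unitization_le_inj -zE lexI rpos_ge0 unitization_le_inj.
  apply: solid_le oB.2 Bt z0 _.
  by rewrite -unitization_le_inj -zE -tE; apply: leI2 => //; exact: rpos_le_rabs.
apply: (Bsup D) => //; apply: supremums_unitization_inj; rewrite -yE.
suff <- : [set Order.meet (rpos p) (inj x) | p in A] = [set inj z | z in D].
  exact: supremums_rpos_meet.
apply/seteqP; split=> [_ [p Ap <-]|_ [z [p Ap zE] <-]]; last by exists p.
have [z zE] := unitization_meet_inj (rpos_ge0 p) x0.
by exists z => //; exists p.
Qed.

(** Testing [|x|] against itself recovers [|x|]; the converse is solidity. *)
Lemma unitization_extend_inj B x : solid B ->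
  unitization_extend B (inj x) <-> B x.
Proof.
move=> sB; rewrite -(solid_rabs x sB); split.
  move=> /(_ _ (rabs_ge0 x)) [y By].
  by rewrite unitization_inj_rabs meetxx => -[->].
move=> Bx y y0; rewrite unitization_inj_rabs unitization_inj_meet.
exists (Order.meet (rabs x) y) => //.
by apply: solid_le sB Bx _ (leIl _ _); rewrite lexI rabs_ge0.
Qed.

Lemma projection_property_ideal :
  projection_property (unitization E) -> projection_property E.
Proof.
move=> ppF B bB; have [[[B0 _ _] Bs] _] := bB.
split; last exact: setI_disjoint_compl.
have [/seteqP[_ /= dec] _] := ppF _ (band_extend bB).
apply/seteqP; split=> // x _; have [p Cp [q dq pq]] := dec (inj x) I.
(* Disjointness of [p] and [q] bounds [p] by their sum [inj x]; hence [p], and then [q], comes from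
   [E]. *)
have px : rabs p <= inj (rabs x).
  rewrite -unitization_inj_rabs -pq; apply: rabs_le_disjointD.
  by rewrite meetC; exact: dq.
have [y yE] := unitization_rabs_le_inj px.
rewrite yE in Cp pq.
exists y; first exact/(unitization_extend_inj _ Bs).
exists (x - y); last by rewrite addrC subrK.
have qE : q = inj (x - y).
  by rewrite unitization_injD unitization_injN -pq addrAC subrr add0r.
move=> z Bz; have := dq (inj z) (proj2 (unitization_extend_inj _ Bs) Bz).
by rewrite qE !unitization_inj_rabs unitization_inj_meet => -[].
Qed.

(** * The unital case: splitting off the line through [1 - u] *)

Section Unital.
Variable u : E.
Hypotheses (u0 : 0 <= u)
  (truncE : forall x, 0 <= x -> trunc x = Order.meet x u).
Let e : unitization E := (- u, 1).

(** For [a > 0], the cone condition says that [y^- / a] is below [u], that is, [- y <= a *: u]. In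
    the coordinates of [unital_decomp] the order is thus componentwise. *)
Lemma unital_unitization_ge0 y a :
  (0 <= (y, a) :> unitization E) = (0 <= a) && (0 <= y + a *: u).
Proof.
rewrite unitization_leE subr0 /unitization_cone.
case: (ltgtP 0 a) => [a0|//|<-] /=; last by rewrite scale0r addr0 orbF.
have n0 : 0 <= a^-1 *: rneg y by apply/rz_invZ_ge0/rneg_ge0.
rewrite trunc_fixed_ge0// truncE// eq_meetl rz_leVZ// rneg_le; last first.
  by apply: riesz_scaler_ge0 => //; exact: ltW.
by rewrite -rz_leBlDl sub0r.
Qed.

Lemma unital_decomp y a : (y, a) = inj (y + a *: u) + a *: e.
Proof. by congr pair; rewrite /= ?scalerN ?addrK ?add0r ?[_ *: _]mulr1. Qed.

(** The [E]-coordinate of [a *: e] is zero, so that of [p] is squeezed to zero. *)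
Lemma unital_below_complement a p : 0 <= p -> p <= a *: e -> p = p.2 *: e.
Proof.
case: p => y b; rewrite unital_unitization_ge0 => /andP[b0 yb0].
rewrite -rz_subr_ge0 (_ : _ - _ = (- (a *: u) - y, a - b)); last first.
  by congr pair; rewrite /= ?scalerN ?[_ *: 1]mulr1.
rewrite unital_unitization_ge0 => /andP[_].
rewrite scalerBl addrC addrACA subrr add0r -opprD -oppr0 rz_leN2 addrC => yb1.
rewrite {1}unital_decomp (_ : y + b *: u = 0) ?add0r//.
by apply/le_anti; rewrite yb0 yb1.
Qed.

Lemma projection_property_unital :
  projection_property E -> projection_property (unitization E).
Proof.
move=> ppE C bC; have [[[C0 CD CZ] Cs] _] := bC.
split; last exact: setI_disjoint_compl.
have [/seteqP[_ /= dec] _] := ppE _ (band_trace bC).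
apply/seteqP; split=> // -[y b] _; rewrite unital_decomp.
have [z Cz [t dt <-]] := dec (y + b *: u) I.
have {}dt := disjoint_compl_trace Cs dt.
(* The term [b *: e] joins the component in [C] if [e] is in [C], and the disjoint one otherwise. *)
have [Ce|nCe] := pselect (C e).
  exists (inj z + b *: e); first by apply: CD => //; exact: CZ.
  by exists (inj t) => //; rewrite unitization_injD addrAC.
exists (inj z) => //; exists (inj t + b *: e); last by rewrite unitization_injD addrA.
apply: disjoint_complD => // p Cp.
have e0 : 0 <= e by rewrite unital_unitization_ge0 ler01 scale1r addNr lexx.
set w := Order.meet _ _.
have w0 : 0 <= w by exact: meet_rabs_ge0.
(* [w] is a multiple of [e] lying in [C]; a nonzero coefficient would put [e] in [C]. *)
have wE : w = w.2 *: e.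
  apply: (@unital_below_complement `|b|) w0 _; apply: le_trans (leIl _ _) _.
  by rewrite -[in leRHS](rabs_ge0_id e0); exact: rabsZ_le.
have Cw : C w by apply: solid_le Cs (proj2 (solid_rabs _ Cs) Cp) w0 (leIr _ _).
have [w20|w2N0] := eqVneq w.2 0; first by rewrite wE w20 scale0r.
by case: nCe; rewrite -(scalerK w2N0 e) -wE; exact: CZ.
Qed.

End Unital.
End Unitization.

Theorem theorem8p2 (R : realType) (E : truncatedRieszType R) :
  (projection_property (unitization E) -> projection_property E) /\
  (unital E -> projection_property E -> projection_property (unitization E)).
Proof.
split; first exact: projection_property_ideal.
by move=> [u u0 truncE]; exact: projection_property_unital truncE.
Qed.
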